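(* Let $\theta_1^1,\theta_1^2,\theta_2^1,\theta_2^2$ be real numbers such that $1,\theta_1^1,\theta_1^2,\theta_2^1,\theta_2^2$ are linearly independent over $\mathbb{Z}$, and let $$\Theta=\begin{pmatrix}\theta_1^1&\theta_1^2\\ \theta_2^1&\theta_2^2\end{pmatrix}$$ (the case $m=n=2$). Then $$\beta(\Theta)\geqslant \alpha(\Theta)\, g_3(\alpha(\Theta)),$$ where for $\alpha\geqslant 1$ $$g_3(\alpha)=\frac{1-\alpha+\sqrt{(1-\alpha)^2+4\alpha(2\alpha^2-2\alpha+1)}}{2\alpha}.$$
   Context: For real $t$, $\|t\|$ denotes the distance from $t$ to the nearest integer. For a real $n\times m$ matrix $\Theta=(\theta_j^i)$ consider the linear forms $L_j(\mathbf{x})=\sum_{i=1}^m\theta_j^i x_i$, $1\le j\le n$, $\mathbf{x}=(x_1,\dots,x_m)$, and $M(\mathbf{x})=\max_{1\le i\le m}|x_i|$. Define $$\psi_\Theta(t)=\min_{\mathbf{x}\in\mathbb{Z}^m:\,0<M(\mathbf{x})\le t}\ \max_{1\le j\le n}\|L_j(\mathbf{x})\|.$$ Assuming $\psi_\Theta(t)>0$ for all $t>0$, the uniform exponent $\alpha(\Theta)$ is the supremum of the set of $\gamma>0$ with $\limsup_{t\to+\infty}t^\gamma\psi_\Theta(t)<+\infty$, and the individual exponent $\beta(\Theta)$ is the supremum of the set of $\gamma>0$ with $\liminf_{t\to+\infty}t^\gamma\psi_\Theta(t)<+\infty$. Here $m=n=2$; in this case one always has $\alpha(\Theta)\ge 1$.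 *)

(* Defs.v *)
From HB Require Import structures.
From mathcomp Require Import all_boot all_order all_algebra.
From mathcomp Require Import all_classical all_reals all_analysis.

Set Implicit Arguments.
Unset Strict Implicit.
Unset Printing Implicit Defensive.
Import Order.TTheory GRing.Theory Num.Theory.
Import numFieldNormedType.Exports.
Local Open Scope classical_set_scope.
Local Open Scope ring_scope.

Definition dist_int (R : realType) (t : R) : R :=
  inf [set `|t - k%:~R| | k in [set: int]].

Definition lin_form (R : realType) (n m : nat) (Theta : 'M[R]_(n, m))
    (j : 'I_n) (x : 'cV[int]_m) : R :=
  \sum_(i < m) Theta j i * (x i 0)%:~R.

(* In the two maxima below, the default value 0 is harmless because all the
   terms are nonnegative. *)
Definition height (m : nat) (x : 'cV[int]_m) : int :=
  \big[Num.max/0]_(i < m) `|x i 0|.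

Definition max_dist (R : realType) (n m : nat) (Theta : 'M[R]_(n, m))
    (x : 'cV[int]_m) : R :=
  \big[Num.max/0]_(j < n) dist_int (lin_form Theta j x).

(* For 0 < m and 1 <= t the set is finite and nonempty, so that the infimum is
   a minimum; for t < 1 it is empty and psi Theta t = 0 by convention, which
   does not affect the behaviour at +oo. *)
Definition psi (R : realType) (n m : nat) (Theta : 'M[R]_(n, m)) (t : R) : R :=
  inf [set max_dist Theta x |
        x in [set x : 'cV[int]_m | 0 < height x /\ (height x)%:~R <= t]].

Definition uniform_exponent (R : realType) (n m : nat)
    (Theta : 'M[R]_(n, m)) : \bar R :=
  ereal_sup [set g%:E | g in [set g : R | 0 < g /\
    (limf_esup (fun t : R => (t `^ g * psi Theta t)%:E) (pinfty_nbhs R)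
       < +oo)%E]].

Definition individual_exponent (R : realType) (n m : nat)
    (Theta : 'M[R]_(n, m)) : \bar R :=
  ereal_sup [set g%:E | g in [set g : R | 0 < g /\
    (limf_einf (fun t : R => (t `^ g * psi Theta t)%:E) (pinfty_nbhs R)
       < +oo)%E]].

Definition Z_lin_indep (R : realType) (k : nat) (v : k.-tuple R) : Prop :=
  forall a : 'I_k -> int,
    \sum_(i < k) (a i)%:~R * tnth v i = 0 -> forall i, a i = 0.

Definition g3 (R : realType) (a : R) : R :=
  (1 - a + Num.sqrt ((1 - a) ^+ 2 + 4 * a * (2 * a ^+ 2 - 2 * a + 1)))
    / (2 * a).

(* The uniform exponent may be +oo; er_map sends +oo to +oo, which is the limit
   of g3 there. *)
Definition g3_ext (R : realType) (a : \bar R) : \bar R := er_map (@g3 R) a.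

(* Main.v *)
(* Let z_0, z_1, ... in Z^4 be the minimal points, with heights X_0 < X_1 < ...
   and errors Z_0 > Z_1 > ..., and let Lambda_j be the plane of z_j, z_{j+1}.
   If a tail of (z_j) lies in a rational hyperplane, linear independence gives
   Z_j X_{j+1} >> 1, so alpha <= 1.  Otherwise there are arbitrarily large
   n < k such that Lambda_j is the same plane for n < j <= k while z_n, z_k,
   z_{k+1}, z_{k+2} are linearly independent, and then:
   (1) a nonzero 4x4 integer determinant gives 1 << Z_n Z_k X_{k+1} X_{k+2};
   (2) the largest minor (x_i, L_l) of a basis of Lambda_j is comparable to
       Z_j X_{j+1}, hence Z_{n+1} X_{n+2} << Z_k X_{k+1}.
   Inserting Z_j << X_{j+1}^(-gamma) and Z_j >= X_j^(-b) for gamma < alpha,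
   b > beta and taking logarithms leaves three linear inequalities in
   ln X_{n+1}, ln X_{k+1}, ln X_{k+2}; they force
   (b - 1)(b - gamma^2 + gamma) >= gamma^2 (gamma - 1), which is stronger than
   the claim because b >= gamma. *)

Require Import Defs.
From HB Require Import structures.
From mathcomp Require Import all_boot all_order all_algebra.
From mathcomp Require Import all_classical all_reals all_analysis.
From mathcomp Require Import ring lra zify.

Set Implicit Arguments.
Unset Strict Implicit.
Unset Printing Implicit Defensive.
Import Order.TTheory GRing.Theory Num.Theory.
Import numFieldNormedType.Exports.
Local Open Scope classical_set_scope.
Local Open Scope ring_scope.

(* (x, y) stands for the vector of Z^4 at which the forms take the values
   L_j(x) - y_j. *)
Notation ipoint := ('cV[int]_2 * 'cV[int]_2)%type.

(** * Coordinates and sup norms on Z^4 *)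

Definition xcoord (R : realType) (i : 'I_2) (z : ipoint) : R := (z.1 i 0)%:~R.

Definition lcoord (R : realType) (Theta : 'M[R]_2) (j : 'I_2) (z : ipoint) : R :=
  lin_form Theta j z.1 - (z.2 j 0)%:~R.

Definition xnorm (R : realType) (z : ipoint) : R :=
  Num.max `|xcoord R 0 z| `|xcoord R 1 z|.

Definition lnorm (R : realType) (Theta : 'M[R]_2) (z : ipoint) : R :=
  Num.max `|lcoord Theta 0 z| `|lcoord Theta 1 z|.

Lemma ord2P (P : 'I_2 -> Prop) : P 0 -> P 1 -> forall i, P i.
Proof.
move=> P0 P1 [[|[|n]] Hn] //.
- by have -> : Ordinal Hn = 0 by apply: val_inj.
- by have -> : Ordinal Hn = 1 by apply: val_inj.
Qed.

Lemma big_ord2 (V : nmodType) (F : 'I_2 -> V) : \sum_(i < 2) F i = F 0 + F 1.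
Proof.
rewrite !big_ord_recl big_ord0 addr0; congr (_ + F _).
by apply: val_inj.
Qed.

Lemma lin_form2E (R : realType) (Theta : 'M[R]_2) j (x : 'cV[int]_2) :
  lin_form Theta j x = Theta j 0 * (x 0 0)%:~R + Theta j 1 * (x 1 0)%:~R.
Proof. by rewrite /lin_form big_ord2. Qed.

Lemma xcoordP (R : realType) i (p : int) (a b : ipoint) :
  xcoord R i (p *: a + b) = p%:~R * xcoord R i a + xcoord R i b.
Proof. by rewrite /xcoord /= !mxE intrD intrM. Qed.

Lemma lcoordP (R : realType) (Theta : 'M[R]_2) i (p : int) (a b : ipoint) :
  lcoord Theta i (p *: a + b) = p%:~R * lcoord Theta i a + lcoord Theta i b.
Proof.
rewrite /lcoord !lin_form2E /= !mxE !intrD !intrM; ring.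
Qed.

Lemma le_xcoord (R : realType) i (z : ipoint) : `|xcoord R i z| <= xnorm R z.
Proof. by move: i; apply: ord2P; rewrite /xnorm le_max lexx ?orbT. Qed.

Lemma le_lcoord (R : realType) (Theta : 'M[R]_2) i (z : ipoint) :
  `|lcoord Theta i z| <= lnorm Theta z.
Proof. by move: i; apply: ord2P; rewrite /lnorm le_max lexx ?orbT. Qed.

Lemma xnorm_witness (R : realType) (z : ipoint) :
  exists i, `|xcoord R i z| = xnorm R z.
Proof.
rewrite /xnorm; case: (leP `|xcoord R 0 z| `|xcoord R 1 z|) => H.
- by exists 1. - by exists 0.
Qed.

Lemma lnorm_witness (R : realType) (Theta : 'M[R]_2) (z : ipoint) :
  exists i, `|lcoord Theta i z| = lnorm Theta z.
Proof.
rewrite /lnorm; case: (leP `|lcoord Theta 0 z| `|lcoord Theta 1 z|) => H.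
- by exists 1. - by exists 0.
Qed.

Lemma xnorm_ge0 (R : realType) (z : ipoint) : 0 <= xnorm R z.
Proof. exact: le_trans (normr_ge0 _) (le_xcoord R 0 z). Qed.

Lemma lnorm_ge0 (R : realType) (Theta : 'M[R]_2) (z : ipoint) :
  0 <= lnorm Theta z.
Proof. exact: le_trans (normr_ge0 _) (le_lcoord Theta 0 z). Qed.

Lemma xnorm_lt (R : realType) (z : ipoint) (B : R) :
  (forall i, `|xcoord R i z| < B) -> xnorm R z < B.
Proof. by move=> H; rewrite gt_max !H. Qed.

Lemma lnorm_lt (R : realType) (Theta : 'M[R]_2) (z : ipoint) (B : R) :
  (forall i, `|lcoord Theta i z| < B) -> lnorm Theta z < B.
Proof. by move=> H; rewrite gt_max !H. Qed.

(** * Minimal points and the planes of consecutive ones *)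

(** Minimality ranges over all nonzero points of Z^4, also those with [u.1 = 0], so it applies to
    any nonzero integer combination of the [z n]. *)
Record minimal_seq (R : realType) (Theta : 'M[R]_2) (z : nat -> ipoint) : Prop := {
  minimal_x : forall n, xnorm R (z n) < xnorm R (z n.+1);
  minimal_l : forall n, lnorm Theta (z n.+1) < lnorm Theta (z n);
  minimal_min : forall n u, u != 0 -> xnorm R u < xnorm R (z n.+1) ->
    lnorm Theta (z n) <= lnorm Theta u }.

(** A mixed Pluecker coordinate of the plane of [a] and [b]: a change of basis multiplies it by the
    determinant of the change. *)
Definition xl_minor (R : realType) (Theta : 'M[R]_2) i j (a b : ipoint) : R :=
  xcoord R i a * lcoord Theta j b - xcoord R i b * lcoord Theta j a.

Lemma minimal_min0 (R : realType) (Theta : 'M[R]_2) z n u :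
  minimal_seq Theta z -> xnorm R u < xnorm R (z n.+1) ->
  lnorm Theta u < lnorm Theta (z n) -> u = 0.
Proof.
move=> Hz Hx Hl; apply/eqP; apply: contraT => u0.
by have := minimal_min Hz u0 Hx; rewrite leNgt Hl.
Qed.

Lemma nearest_int (R : realType) (t : R) : exists m : int, `|t - m%:~R| <= 2^-1.
Proof.
exists (Num.floor (t + 2^-1)).
have /andP[] := floor_itv (t + 2^-1); rewrite intrD ler_norml => h1 h2; lra.
Qed.

(* Two consecutive minimal points form a basis of the integer points of the
   plane they span: rounding s and t leaves a point that is too small. *)
Lemma minimal_lattice (R : realType) (Theta : 'M[R]_2) z n (s t : R) :
  minimal_seq Theta z ->
  (forall i, xcoord R i (z n.+2) = s * xcoord R i (z n) + t * xcoord R i (z n.+1)) ->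
  (forall j, lcoord Theta j (z n.+2) =
     s * lcoord Theta j (z n) + t * lcoord Theta j (z n.+1)) ->
  exists p q : int, z n.+2 = p *: z n + q *: z n.+1.
Proof.
move=> Hz Hx Hl.
have [p Hp] := nearest_int s; have [q Hq] := nearest_int t.
exists p, q.
pose u := z n.+2 - (p *: z n + q *: z n.+1).
have uE : u = (- p) *: z n + ((- q) *: z n.+1 + z n.+2).
  by rewrite /u !scaleNr opprD [LHS]addrC -addrA.
suff : u = 0 by move/eqP; rewrite subr_eq0 => /eqP.
(* The rounding errors are at most 1/2, so [u] has height at most (X_n + X_{n+1})/2 < X_{n+1} and
   error at most (Z_n + Z_{n+1})/2 < Z_n. *)
have X1 := minimal_x Hz n; have L1 := minimal_l Hz n.
apply: (minimal_min0 (n := n) Hz).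
- apply: xnorm_lt => i; rewrite uE !xcoordP Hx.
  have := le_xcoord R i (z n); have := le_xcoord R i (z n.+1).
  move: (xcoord R i (z n)) (xcoord R i (z n.+1)) => a b Hb Ha.
  have -> : (- p)%:~R * a + ((- q)%:~R * b + (s * a + t * b)) =
    (s - p%:~R) * a + (t - q%:~R) * b by rewrite !intrN; ring.
  apply: le_lt_trans (ler_normD _ _) _; rewrite !normrM.
  have := ler_pM (normr_ge0 _) (normr_ge0 _) Hp Ha.
  have := ler_pM (normr_ge0 _) (normr_ge0 _) Hq Hb.
  lra.
- apply: lnorm_lt => i; rewrite uE !lcoordP Hl.
  have := le_lcoord Theta i (z n); have := le_lcoord Theta i (z n.+1).
  move: (lcoord Theta i (z n)) (lcoord Theta i (z n.+1)) => a b Hb Ha.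
  have -> : (- p)%:~R * a + ((- q)%:~R * b + (s * a + t * b)) =
    (s - p%:~R) * a + (t - q%:~R) * b by rewrite !intrN; ring.
  apply: le_lt_trans (ler_normD _ _) _; rewrite !normrM.
  have := ler_pM (normr_ge0 _) (normr_ge0 _) Hp Ha.
  have := ler_pM (normr_ge0 _) (normr_ge0 _) Hq Hb.
  lra.
Qed.

Lemma xl_minor_le (R : realType) (Theta : 'M[R]_2) z n i j :
  minimal_seq Theta z ->
  `|xl_minor Theta i j (z n) (z n.+1)| <=
    2 * (lnorm Theta (z n) * xnorm R (z n.+1)).
Proof.
move=> Hz; have X1 := minimal_x Hz n; have L1 := minimal_l Hz n.
rewrite /xl_minor; apply: le_trans (ler_normB _ _) _; rewrite !normrM.
have := ler_pM (normr_ge0 _) (normr_ge0 _)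
  (le_trans (le_xcoord R i (z n)) (ltW X1))
  (le_trans (le_lcoord Theta j (z n.+1)) (ltW L1)).
have := ler_pM (normr_ge0 _) (normr_ge0 _) (le_xcoord R i (z n.+1))
  (le_lcoord Theta j (z n)).
lra.
Qed.

Lemma xnormZ (R : realType) (p : int) (z : ipoint) :
  xnorm R (p *: z) = `|p%:~R| * xnorm R z.
Proof.
have E i : `|xcoord R i (p *: z)| = `|p%:~R| * `|xcoord R i z|.
  by rewrite /xcoord /= !mxE intrM normrM.
by rewrite /xnorm !E maxr_pMr.
Qed.

Lemma lnormZ (R : realType) (Theta : 'M[R]_2) (p : int) (z : ipoint) :
  lnorm Theta (p *: z) = `|p%:~R| * lnorm Theta z.
Proof.
have E i : `|lcoord Theta i (p *: z)| = `|p%:~R| * `|lcoord Theta i z|.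
  by rewrite -normrM /lcoord !lin_form2E /= !mxE !intrM; congr `|_|; ring.
by rewrite /lnorm !E maxr_pMr.
Qed.

(** If q were nonzero, comparing heights would give |p| > |q|, and comparing errors |p| < |q|. *)
Lemma minimal_indep2 (R : realType) (Theta : 'M[R]_2) z n (p q : int) :
  minimal_seq Theta z -> p *: z n = q *: z n.+1 -> p = 0 /\ q = 0.
Proof.
move=> Hz E; have X1 := minimal_x Hz n; have L1 := minimal_l Hz n.
have := congr1 (xnorm R) E; have := congr1 (lnorm Theta) E.
rewrite !xnormZ !lnormZ => El Ex.
have X0 := xnorm_ge0 R (z n); have L0 := lnorm_ge0 Theta (z n.+1).
have q0 : q = 0.
  apply/eqP; apply: contraT => q0.
  have Q0 : 0 < `|q%:~R : R| by rewrite normr_gt0 intr_eq0.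
  have pq : `|q%:~R| < `|p%:~R : R|.
    rewrite ltNge; apply/negP => H.
    have := ler_wpM2r X0 H; have := ltr_pM2l Q0 (xnorm R (z n)) (xnorm R (z n.+1)).
    by rewrite X1 Ex => /= H1 H2; move: (lt_le_trans H1 H2); rewrite ltxx.
  have := ltr_pM2l Q0 (lnorm Theta (z n.+1)) (lnorm Theta (z n)); rewrite L1 -El.
  have L2 : 0 < lnorm Theta (z n) by exact: le_lt_trans L0 L1.
  have := ltr_pM2r L2 `|q%:~R| `|p%:~R|; rewrite pq => h1 h2.
  by have := lt_trans h1 h2; rewrite ltxx.
split=> //; move/eqP: El; rewrite q0 normr0 mul0r mulf_eq0 normr_eq0 intr_eq0.
case/orP => /eqP // El'; by move: L1; rewrite El' ltNge L0.
Qed.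

(* If all these minors were small, z_{n+1} would be close to z_n or to - z_n in
   all coordinates, and their difference or sum would violate minimality. *)
Lemma xl_minor_ge (R : realType) (Theta : 'M[R]_2) z n :
  minimal_seq Theta z ->
  exists i j, lnorm Theta (z n) * xnorm R (z n.+1) <=
    4 * `|xl_minor Theta i j (z n) (z n.+1)|.
Proof.
move=> Hz; apply: contrapT => Hn.
have X1 := minimal_x Hz n; have L1 := minimal_l Hz n.
have X0 := xnorm_ge0 R (z n); have L0 := lnorm_ge0 Theta (z n.+1).
have H i j : 4 * `|xl_minor Theta i j (z n) (z n.+1)| <
    lnorm Theta (z n) * xnorm R (z n.+1).
  by rewrite ltNge; apply/negP => h; apply: Hn; exists i, j.
have [i0 Hi0] := xnorm_witness R (z n.+1).
have [j0 Hj0] := lnorm_witness Theta (z n).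
set A := xcoord R i0 (z n.+1) in Hi0; set b := lcoord Theta j0 (z n) in Hj0.
have A0 : A != 0 by rewrite -normr_gt0 Hi0; lra.
have b0 : b != 0 by rewrite -normr_gt0 Hj0; lra.
(* Small minors through the pivots [i0] and [j0] make the errors of z_n close to r times those of
   z_{n+1}, and the x-coordinates of z_{n+1} close to s times those of z_n. *)
pose r := xcoord R i0 (z n) / A; pose s := lcoord Theta j0 (z n.+1) / b.
have r1 : `|r| <= 1.
  rewrite normrM normfV ler_pdivrMr ?normr_gt0 // mul1r Hi0.
  exact: le_trans (le_xcoord _ _ _) (ltW X1).
have s1 : `|s| <= 1.
  rewrite normrM normfV ler_pdivrMr ?normr_gt0 // mul1r Hj0.
  exact: le_trans (le_lcoord _ _ _) (ltW L1).
have rl j : `|r * lcoord Theta j (z n.+1) - lcoord Theta j (z n)| <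
    4^-1 * lnorm Theta (z n).
  have := H i0 j; rewrite -Hi0.
  have -> : xl_minor Theta i0 j (z n) (z n.+1) =
     A * (r * lcoord Theta j (z n.+1) - lcoord Theta j (z n)).
    by rewrite /xl_minor /r -/A; field.
  rewrite normrM mulrCA mulrC ltr_pM2r ?normr_gt0 //; lra.
have sx i : `|s * xcoord R i (z n) - xcoord R i (z n.+1)| <
    4^-1 * xnorm R (z n.+1).
  have := H i j0; rewrite -Hj0.
  have -> : xl_minor Theta i j0 (z n) (z n.+1) =
     b * (s * xcoord R i (z n) - xcoord R i (z n.+1)).
    by rewrite /xl_minor /s -/b; field.
  rewrite normrM mulrCA ltr_pM2l ?normr_gt0 //; lra.
have rs : `|r * s - 1| < 4^-1.
  have := rl j0; rewrite -/b -Hj0.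
  have -> : r * lcoord Theta j0 (z n.+1) - b = b * (r * s - 1).
    by rewrite /s; field.
  by rewrite normrM mulrC ltr_pM2r ?normr_gt0.
(* As |r|, |s| <= 1 and r s > 3/4, both numbers have the same sign and absolute value above 3/4; [e]
   is that sign. *)
have [e [He er es]] : exists e : int, [/\ (e%:~R : R) ^+ 2 = 1,
    `|e%:~R - r| <= 4^-1 & `|e%:~R - s| <= 4^-1].
  move: r1 s1 rs; rewrite !ler_norml ltr_norml => /andP[r1 r2] /andP[s1 s2] /andP[h1 h2].
  case: (lerP 0 r) => r0.
  - exists 1; split; first by rewrite expr1n.
    + by rewrite mulr1z ler_norml; apply/andP; split; nra.
    + by rewrite mulr1z ler_norml; apply/andP; split; nra.
  - exists (-1); rewrite mulrN1z; split; first by ring.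
    + by rewrite ler_norml; apply/andP; split; nra.
    + by rewrite ler_norml; apply/andP; split; nra.
have e1 : `|e%:~R : R| = 1.
  by apply/eqP; rewrite -sqr_norm_eq1 He.
pose u := (- e) *: z n + z n.+1.
suff u0 : u = 0.
  have [] // := @minimal_indep2 R Theta z n e 1 Hz.
  by rewrite scale1r; apply/esym/eqP; rewrite -subr_eq0 addrC -scaleNr -/u u0.
apply: (minimal_min0 (n := n) Hz).
- apply: xnorm_lt => i; rewrite xcoordP; move: (sx i) (le_xcoord R i (z n)).
  move: (xcoord R i (z n)) (xcoord R i (z n.+1)) => x y h1 h2.
  have -> : (- e)%:~R * x + y = - ((e%:~R - s) * x + (s * x - y)).
    by rewrite intrN; ring.
  rewrite normrN; apply: le_lt_trans (ler_normD _ _) _; rewrite normrM.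
  have := ler_pM (normr_ge0 _) (normr_ge0 _) es h2; lra.
- apply: lnorm_lt => i; rewrite lcoordP; move: (rl i) (le_lcoord Theta i (z n.+1)).
  move: (lcoord Theta i (z n)) (lcoord Theta i (z n.+1)) => x y h1 h2.
  have -> : (- e)%:~R * x + y = e%:~R * ((e%:~R - r) * y + (r * y - x)).
    transitivity (e%:~R ^+ 2 * y - e%:~R * x); last by ring.
    by rewrite He intrN; ring.
  rewrite normrM e1 mul1r; apply: le_lt_trans (ler_normD _ _) _; rewrite normrM.
  have := ler_pM (normr_ge0 _) (normr_ge0 _) er h2; lra.
Qed.

(** * Runs of minimal points in a common plane *)

(** Rational dependence with denominators cleared; for a minimal sequence it says that Lambda_n =
    Lambda_{n+1}. *)
Definition coplanar (z : nat -> ipoint) n : Prop :=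
  exists a b c : int, c != 0 /\ c *: z n.+2 = a *: z n + b *: z n.+1.

(** Integrality comes from [minimal_lattice]; p = 0 would make z_{n+2} a multiple of z_{n+1}. *)
Lemma coplanar_int (R : realType) (Theta : 'M[R]_2) z n :
  minimal_seq Theta z -> coplanar z n ->
  exists p q : int, p != 0 /\ z n.+2 = p *: z n + q *: z n.+1.
Proof.
move=> Hz [a [b [c [c0 E]]]].
have C0 : c%:~R != 0 :> R by rewrite intr_eq0.
have [i|j|p [q Epq]] := @minimal_lattice R Theta z n (a%:~R / c%:~R) (b%:~R / c%:~R) Hz.
- have := congr1 (xcoord R i) E.
  rewrite -[c *: _]addr0 -[b *: _]addr0 !xcoordP /xcoord /= !mxE !mulr0z !addr0 => h.
  by apply: (mulfI C0); rewrite h; field.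
- have := congr1 (lcoord Theta j) E.
  have l0 : lcoord Theta j 0 = 0 by rewrite /lcoord lin_form2E /= !mxE; ring.
  rewrite -[c *: _]addr0 -[b *: _]addr0 !lcoordP l0 !addr0 => h.
  by apply: (mulfI C0); rewrite h; field.
- exists p, q; split=> //; apply/negP => /eqP p0.
  have [] := @minimal_indep2 R Theta z n.+1 q 1 Hz.
    by rewrite scale1r Epq p0 scale0r add0r.
  by [].
Qed.

(** The change of basis from (z_n, z_{n+1}) to (z_{n+1}, z_{n+2}) has determinant -p for a nonzero
    integer p. *)
Lemma xl_minor_step (R : realType) (Theta : 'M[R]_2) z n i j :
  minimal_seq Theta z -> coplanar z n ->
  `|xl_minor Theta i j (z n) (z n.+1)| <= `|xl_minor Theta i j (z n.+1) (z n.+2)|.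
Proof.
move=> Hz /(coplanar_int Hz) [p [q [p0 E]]].
have -> : xl_minor Theta i j (z n.+1) (z n.+2) =
    - p%:~R * xl_minor Theta i j (z n) (z n.+1).
  rewrite /xl_minor E -[q *: _]addr0 !xcoordP !lcoordP.
  have l0 : lcoord Theta j 0 = 0 by rewrite /lcoord lin_form2E /= !mxE; ring.
  have x0 : xcoord R i 0 = 0 by rewrite /xcoord /= mxE.
  by rewrite l0 x0; ring.
rewrite normrM normrN ler_peMl // -intr_norm ler1z.
by rewrite -gtz0_ge1 normr_gt0.
Qed.

(** A minor that is large at n, up to the factor 4, does not decrease along the run and is bounded
    at k with the factor 2; hence 8. *)
Lemma coplanar_range (R : realType) (Theta : 'M[R]_2) z n k :
  minimal_seq Theta z -> (n <= k)%N ->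
  (forall m, (n <= m < k)%N -> coplanar z m) ->
  lnorm Theta (z n) * xnorm R (z n.+1) <= 8 * (lnorm Theta (z k) * xnorm R (z k.+1)).
Proof.
move=> Hz; have [i [j Hij]] := xl_minor_ge n Hz => nk Hc.
have : `|xl_minor Theta i j (z n) (z n.+1)| <= `|xl_minor Theta i j (z k) (z k.+1)|.
  move: Hc; rewrite -(subnKC nk); elim: (k - n)%N => [|d IH] Hc; first by rewrite addn0.
  apply: (le_trans (IH _)).
    by move=> m /andP[h1 h2]; apply: Hc; rewrite h1 addnS ltnS ltnW.
  rewrite addnS; apply: xl_minor_step => //; apply: Hc.
  by rewrite leq_addr addnS ltnSn.
have := xl_minor_le k i j Hz; lra.
Qed.

(** * Integer determinants and rational hyperplanes in Z^4 *)

Definition coords (z : ipoint) : seq int :=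
  [:: z.1 0 0; z.1 1 0; z.2 0 0; z.2 1 0].

Definition point_mx (a b c d : ipoint) : 'M[int]_4 :=
  \matrix_(i, k) nth 0 (coords (nth 0 [:: a; b; c; d] i)) k.

Definition dot (h z : ipoint) : int :=
  h.1 0 0 * z.1 0 0 + h.1 1 0 * z.1 1 0 + h.2 0 0 * z.2 0 0 + h.2 1 0 * z.2 1 0.

Lemma dotP h (p : int) a b : dot h (p *: a + b) = p * dot h a + dot h b.
Proof. rewrite /dot /= !mxE; ring. Qed.

Lemma dot0 h : dot h 0 = 0.
Proof. by rewrite /dot /= !mxE !mulr0. Qed.

Lemma dotZ h (p : int) a : dot h (p *: a) = p * dot h a.
Proof. by rewrite -[p *: a]addr0 dotP dot0 addr0. Qed.

Lemma point_eq (a b : ipoint) : (forall i, a.1 i 0 = b.1 i 0) ->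
  (forall i, a.2 i 0 = b.2 i 0) -> a = b.
Proof.
by case: a b => [a1 a2] [b1 b2] /= H1 H2; congr pair;
  apply/matrixP => i j; rewrite (ord1 j).
Qed.

Lemma big_ord4 (V : nmodType) (F : 'I_4 -> V) :
  \sum_(i < 4) F i = F 0 + F 1 + F 2 + F 3.
Proof.
rewrite !big_ord_recl big_ord0 addr0 !addrA.
by congr (_ + F _ + F _ + F _); apply: val_inj.
Qed.

Lemma ord4P (P : 'I_4 -> Prop) : P 0 -> P 1 -> P 2 -> P 3 -> forall i, P i.
Proof.
move=> P0 P1 P2 P3 [[|[|[|[|n]]]] Hn] //.
- by have -> : Ordinal Hn = 0 by apply: val_inj.
- by have -> : Ordinal Hn = 1 by apply: val_inj.
- by have -> : Ordinal Hn = 2 by apply: val_inj.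
- by have -> : Ordinal Hn = 3 by apply: val_inj.
Qed.

Lemma point_mx_dep a b c d : \det (point_mx a b c d) = 0 ->
  exists p q r s : int, [|| p != 0, q != 0, r != 0 | s != 0] /\
    p *: a + (q *: b + (r *: c + s *: d)) = 0.
Proof.
move/eqP/det0P => [v v0 /rowP Hv].
exists (v 0 0), (v 0 1), (v 0 2), (v 0 3); split.
  apply: contraNT v0; rewrite !negb_or !negbK => /and4P[/eqP h0 /eqP h1 /eqP h2 /eqP h3].
  by apply/eqP/rowP; apply: ord4P; rewrite mxE.
by apply: point_eq; apply: ord2P; rewrite /= !mxE;
  [have := Hv 0|have := Hv 1|have := Hv 2|have := Hv 3];
  rewrite !mxE big_ord4 !mxE /= => h; lia.
Qed.

(** With a zero fourth row the matrix is singular, and a kernel vector of its transpose is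
    orthogonal to all rows. *)
Lemma exists_hyperplane a b c :
  exists h, [/\ h != 0, dot h a = 0, dot h b = 0 & dot h c = 0].
Proof.
have : \det (point_mx a b c 0)^T == 0.
  rewrite det_tr; apply/det0P; exists (delta_mx 0 3).
    by apply/eqP => /rowP /(_ 3); rewrite !mxE eqxx.
  by apply/rowP => i; rewrite !mxE big_ord4 !mxE /=; move: i; apply: ord4P; rewrite /= mxE; lia.
case/det0P => v v0 /rowP Hv.
pose h : ipoint := (\col_i v 0 (if i == 0 then 0 else 1),
                   \col_i v 0 (if i == 0 then 2 else 3)).
have E z : dot h z =
    v 0 0 * z.1 0 0 + v 0 1 * z.1 1 0 + v 0 2 * z.2 0 0 + v 0 3 * z.2 1 0.
  by rewrite /dot /= !mxE.
exists h; split.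
- apply: contra v0 => /eqP [/colP h1 /colP h2]; apply/eqP/rowP.
  have := h1 0; have := h1 1; have := h2 0; have := h2 1.
  by rewrite !mxE /= => e3 e2 e1 e0; apply: ord4P; rewrite mxE.
- by have := Hv 0; rewrite E !mxE big_ord4 !mxE.
- by have := Hv 1; rewrite E !mxE big_ord4 !mxE.
- by have := Hv 2; rewrite E !mxE big_ord4 !mxE.
Qed.

Lemma det_mx2 (R : comNzRingType) (A : 'M[R]_2) :
  \det A = A 0 0 * A 1 1 - A 0 1 * A 1 0.
Proof.
rewrite (expand_det_row _ 0) big_ord2 /cofactor !det_mx11 !mxE /=.
have -> : lift 0 0 = 1 :> 'I_2 by apply: val_inj.
have -> : lift 1 0 = 0 :> 'I_2 by apply: val_inj.
rewrite expr0 expr1; ring.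
Qed.

(** Laplace expansion along the first two columns, over the six splittings of the points into two
    pairs. *)
Lemma det_point_mx a b c d (M := fun (F G : ipoint -> int) u v => F u * G v - F v * G u)
    (X := M (fun z => z.1 0 0) (fun z => z.1 1 0))
    (Y := M (fun z => z.2 0 0) (fun z => z.2 1 0)) :
  \det (point_mx a b c d) =
   X a b * Y c d - X a c * Y b d + X a d * Y b c +
   X b c * Y a d - X b d * Y a c + X c d * Y a b.
Proof.
rewrite (expand_det_row _ 0) big_ord4 /cofactor.
rewrite !(expand_det_row _ (0 : 'I_3)) !big_ord_recl !big_ord0 /cofactor !det_mx2.
rewrite !mxE /= /bump /= /X /Y /M; ring.
Qed.

(** Replacing the columns y_j by L_j(x) - y_j adds multiples of the x-columns and changes two signs,
    so the determinant stays the same. *)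
Lemma det_point_mxR (R : realType) (Theta : 'M[R]_2) a b c d
    (M := fun (F G : ipoint -> R) u v => F u * G v - F v * G u)
    (X := M (xcoord R 0) (xcoord R 1))
    (L := M (lcoord Theta 0) (lcoord Theta 1)) :
  (\det (point_mx a b c d))%:~R =
   X a b * L c d - X a c * L b d + X a d * L b c +
   X b c * L a d - X b d * L a c + X c d * L a b :> R.
Proof.
rewrite det_point_mx /X /L /M /lcoord !lin_form2E /xcoord.
rewrite !(intrD, intrN, intrB, intrM); ring.
Qed.

(** In each of the six terms of the expansion the two heights are dominated by those of c and d, the
    two errors by those of a and b; each 2x2 minor costs a factor 2, and 6 * 2 * 2 = 24. *)
Lemma det_point_mx_le (R : realType) (Theta : 'M[R]_2) a b c d :
  xnorm R a <= xnorm R b -> xnorm R b <= xnorm R c -> xnorm R c <= xnorm R d ->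
  lnorm Theta d <= lnorm Theta c -> lnorm Theta c <= lnorm Theta b ->
  lnorm Theta b <= lnorm Theta a ->
  `|(\det (point_mx a b c d))%:~R| <=
    24 * (lnorm Theta a * lnorm Theta b * (xnorm R c * xnorm R d)).
Proof.
move=> xab xbc xcd ldc lcb lba; rewrite (det_point_mxR Theta).
have X u v : `|xcoord R 0 u * xcoord R 1 v - xcoord R 0 v * xcoord R 1 u|
    <= 2 * (xnorm R u * xnorm R v).
  apply: le_trans (ler_normB _ _) _; rewrite !normrM.
  have := ler_pM (normr_ge0 _) (normr_ge0 _) (le_xcoord R 0 u) (le_xcoord R 1 v).
  have := ler_pM (normr_ge0 _) (normr_ge0 _) (le_xcoord R 0 v) (le_xcoord R 1 u); lra.
have L u v : `|lcoord Theta 0 u * lcoord Theta 1 v - lcoord Theta 0 v * lcoord Theta 1 u|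
    <= 2 * (lnorm Theta u * lnorm Theta v).
  apply: le_trans (ler_normB _ _) _; rewrite !normrM.
  have := ler_pM (normr_ge0 _) (normr_ge0 _) (le_lcoord Theta 0 u) (le_lcoord Theta 1 v).
  have := ler_pM (normr_ge0 _) (normr_ge0 _) (le_lcoord Theta 0 v) (le_lcoord Theta 1 u); lra.
have P u v s t : xnorm R u <= xnorm R c -> xnorm R v <= xnorm R d ->
    lnorm Theta s <= lnorm Theta a -> lnorm Theta t <= lnorm Theta b ->
    `|(xcoord R 0 u * xcoord R 1 v - xcoord R 0 v * xcoord R 1 u) *
     (lcoord Theta 0 s * lcoord Theta 1 t - lcoord Theta 0 t * lcoord Theta 1 s)| <=
    4 * (lnorm Theta a * lnorm Theta b * (xnorm R c * xnorm R d)).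
  move=> hu hv hs ht; rewrite normrM.
  apply: le_trans (ler_pM (normr_ge0 _) (normr_ge0 _) (X u v) (L s t)) _.
  have h1 := ler_pM (xnorm_ge0 R u) (xnorm_ge0 R v) hu hv.
  have h2 := ler_pM (lnorm_ge0 Theta s) (lnorm_ge0 Theta t) hs ht.
  have := ler_pM (mulr_ge0 (xnorm_ge0 R u) (xnorm_ge0 R v))
    (mulr_ge0 (lnorm_ge0 Theta s) (lnorm_ge0 Theta t)) h1 h2.
  lra.
have xac := le_trans xab xbc; have xbd := le_trans xbc xcd.
have ldb := le_trans ldc lcb; have lca := le_trans lcb lba.
have P1 := P a b c d xac xbd lca ldb.
have P2 := P a c b d xac xcd lba ldb.
have P3 := P a d b c xac (lexx _) lba lcb.
have P4 := P b c a d xbc xcd (lexx _) ldb.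
have P5 := P b d a c xbc (lexx _) (lexx _) lcb.
have P6 := P c d a b (lexx _) (lexx _) (lexx _) (lexx _).
move: P1 P2 P3 P4 P5 P6.
set E := 4 * _ => P1 P2 P3 P4 P5 P6.
have -> : 24 * (lnorm Theta a * lnorm Theta b * (xnorm R c * xnorm R d)) =
  E + E + E + E + E + E by rewrite /E; ring.
apply: le_trans (ler_normD _ _) _; apply: lerD; last exact: P6.
apply: le_trans (ler_normB _ _) _; apply: lerD; last exact: P5.
apply: le_trans (ler_normD _ _) _; apply: lerD; last exact: P4.
apply: le_trans (ler_normD _ _) _; apply: lerD; last exact: P3.
by apply: le_trans (ler_normB _ _) _; apply: lerD; [exact: P1|exact: P2].
Qed.

Lemma det_point_mx_ge1 (R : realType) a b c d :
  \det (point_mx a b c d) != 0 -> 1 <= `|(\det (point_mx a b c d))%:~R : R|.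
Proof. by move=> h; rewrite -intr_norm ler1z -gtz0_ge1 normr_gt0. Qed.

(** * The choice of four independent minimal points *)

(** All pairs z_j, z_{j+1} of the run span Lambda_{n+1}, which does not contain z_n. The induction
    substitutes z_{j+2} = a z_j + b z_{j+1} with a nonzero into the relation. *)
Lemma indep_triple (R : realType) (Theta : 'M[R]_2) z n j :
  minimal_seq Theta z -> ~ coplanar z n -> (n < j)%N ->
  (forall m, (n < m < j)%N -> coplanar z m) ->
  forall p q r : int, p *: z n + (q *: z j + r *: z j.+1) = 0 ->
  [/\ p = 0, q = 0 & r = 0].
Proof.
move=> Hz Hn nj; rewrite -(subnKC nj); elim: (j - n.+1)%N => [|d IH] Hc p q r.
- rewrite addn0 => E.
  have [r0|r0] := eqVneq r 0; last first.
    case: Hn; exists p, q, (- r); split; first by rewrite oppr_eq0.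
    by apply/esym/eqP; rewrite scaleNr -addr_eq0 -addrA E.
  have [] := @minimal_indep2 R Theta z n p (- q) Hz.
    by apply/eqP; move/eqP: E; rewrite r0 scale0r addr0 addr_eq0 scaleNr.
  by move=> -> /eqP; rewrite oppr_eq0 => /eqP ->.
- have Hd : coplanar z (n.+1 + d) by apply: Hc; lia.
  have [a [b [a0 E]]] := coplanar_int Hz Hd.
  rewrite addnS E => H.
  have [| |p0 /eqP ra0 qr0] := IH _ p (r * a) (q + r * b).
  + by move=> m /andP[h1 h2]; apply: Hc; lia.
  + rewrite -[RHS]H; congr (_ + _).
    by rewrite scalerDr scalerDl !scalerA [RHS]addrCA.
  + move: ra0; rewrite mulf_eq0 (negbTE a0) orbF => /eqP r0.
    by split=> //; move: qr0; rewrite r0 mul0r addr0.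
Qed.

(** Otherwise the tail would stay in the plane of z_N and z_{N+1}, hence in any hyperplane through
    these two points. *)
Lemma exists_not_coplanar (z : nat -> ipoint) N :
  (forall h n0, h != 0 -> exists2 n, (n0 <= n)%N & dot h (z n) != 0) ->
  exists2 n, (N <= n)%N & ~ coplanar z n.
Proof.
move=> Hh; apply: contrapT => Hn.
have Hc n : (N <= n)%N -> coplanar z n.
  by move=> Nn; apply: contrapT => h; apply: Hn; exists n.
have [h [h0 hN hN1 _]] := exists_hyperplane (z N) (z N.+1) 0.
have [n Nn /eqP []] := Hh h N h0.
suff : dot h (z n) = 0 /\ dot h (z n.+1) = 0 by case.
rewrite -(subnKC Nn); elim: (n - N)%N => [|d [IH1 IH2]]; first by rewrite addn0.
rewrite addnS; split=> //.
have [a [b [c [c0 E]]]] := Hc (N + d)%N (leq_addr _ _).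
have /eqP := congr1 (dot h) E.
rewrite dotZ dotP dotZ IH1 IH2 !mulr0 addr0 mulf_eq0 (negbTE c0).
by move/eqP.
Qed.

(* Take a hyperplane h through a noncoplanar triple z_m0, z_m0+1, z_m0+2, let
   z_{k+2} be the first later point off h, and let n be the last noncoplanar
   index before k. *)
Lemma exists_transition (R : realType) (Theta : 'M[R]_2) z N :
  minimal_seq Theta z ->
  (forall h n0, h != 0 -> exists2 n, (n0 <= n)%N & dot h (z n) != 0) ->
  exists n k, [/\ (N <= n)%N, (n < k)%N,
    (forall m, (n < m < k)%N -> coplanar z m) &
    \det (point_mx (z n) (z k) (z k.+1) (z k.+2)) != 0].
Proof.
move=> Hz Hh.
have [m0 Nm0 Hm0] := exists_not_coplanar N Hh.
have [h [h0 hm0 hm1 hm2]] := exists_hyperplane (z m0) (z m0.+1) (z m0.+2).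
have exk : exists n, (m0 <= n)%N && (dot h (z n) != 0).
  by have [n h1 h2] := Hh h m0 h0; exists n; rewrite h1 h2.
case: (ex_minnP exk) => k2 /andP[m0k hk2] mink.
have hlt m : (m0 <= m < k2)%N -> dot h (z m) = 0.
  move=> /andP[h1 h2]; apply/eqP; apply: contraT => h3.
  by have := mink m; rewrite h1 h3 leqNgt h2 => /(_ isT).
have k2gt : (m0.+2 < k2)%N.
  rewrite ltnNge; apply/negP => h1.
  have : k2 = m0 \/ k2 = m0.+1 \/ k2 = m0.+2 by lia.
  by case=> [|[|]] e; move: hk2; rewrite e ?hm0 ?hm1 ?hm2 eqxx.
pose k := k2.-2; have k2E : k2 = k.+2 by rewrite /k; lia.
have exn : exists n, (m0 <= n < k)%N && ~~ `[< coplanar z n >].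
  by exists m0; apply/andP; split; [rewrite /k; lia|apply/asboolPn].
have bdn n : (m0 <= n < k)%N && ~~ `[< coplanar z n >] -> (n <= k)%N.
  by move=> /andP[/andP[_ /ltnW]].
case: (ex_maxnP exn bdn) => n /andP[/andP[m0n nk] /asboolPn Hn] maxn.
have Hc m : (n < m < k)%N -> coplanar z m.
  move=> /andP[h1 h2]; apply: contrapT => /asboolPn h3.
  by have := maxn m; rewrite h3 h2 (leq_trans m0n (ltnW h1)) leqNgt h1 => /(_ isT).
exists n, k; split=> //; first exact: leq_trans Nm0 m0n.
(* Applying [h] to a relation kills every term but that of z_{k+2}, so s = 0; the other three points
   are independent by [indep_triple]. *)
apply/negP => /eqP /point_mx_dep [p [q [r [s [nz E]]]]].
have s0 : s = 0.
  have := congr1 (dot h) E; rewrite dot0 !dotP dotZ (hlt n) ?(hlt k) ?(hlt k.+1); try by rewrite k2E; lia.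
  move/eqP; rewrite !mulr0 !add0r mulf_eq0 -k2E (negbTE hk2) orbF.
  by move/eqP.
move: E; rewrite s0 scale0r addr0 => E.
have [p0 q0 r0] := indep_triple Hz Hn nk Hc E.
by move: nz; rewrite p0 q0 r0 s0 eqxx.
Qed.

(** * Consequences of linear independence over Z *)

Lemma Z_lin_indep5 (R : realType) (v : 5.-tuple R) (a b c d e : int) :
  Z_lin_indep v ->
  a%:~R * tnth v 0 + b%:~R * tnth v 1 + c%:~R * tnth v 2 + d%:~R * tnth v 3 +
    e%:~R * tnth v 4 = 0 -> [/\ a = 0, b = 0, c = 0, d = 0 & e = 0].
Proof.
move=> Hv E; pose f (i : 'I_5) := nth 0 [:: a; b; c; d; e] i.
have H : forall i, f i = 0.
  apply: Hv; rewrite -[RHS]E !big_ord_recl big_ord0 addr0 !addrA /f /=.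
  by congr (_ * tnth v _ + _ * tnth v _ + _ * tnth v _ + _ * tnth v _ +
    _ * tnth v _); apply: val_inj.
by split; [have := H 0|have := H 1|have := H 2|have := H 3|have := H 4].
Qed.

Lemma indepE (R : realType) (Theta : 'M[R]_2) (a b c d e : int) :
  Z_lin_indep [tuple 1; Theta 0 0; Theta 0 1; Theta 1 0; Theta 1 1] ->
  a%:~R + b%:~R * Theta 0 0 + c%:~R * Theta 0 1 + d%:~R * Theta 1 0 +
    e%:~R * Theta 1 1 = 0 -> [/\ a = 0, b = 0, c = 0, d = 0 & e = 0].
Proof.
move=> Hv E; apply: (Z_lin_indep5 Hv).
by rewrite !(tnth_nth 0) /= mulr1.
Qed.

Lemma lcoord_neq0 (R : realType) (Theta : 'M[R]_2) (z : ipoint) :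
  Z_lin_indep [tuple 1; Theta 0 0; Theta 0 1; Theta 1 0; Theta 1 1] ->
  z.1 != 0 -> lcoord Theta 0 z != 0.
Proof.
move=> Hv; apply: contra => /eqP; rewrite /lcoord lin_form2E => E.
have [|_ h1 h2 _ _] := @indepE R Theta (- z.2 0 0) (z.1 0 0) (z.1 1 0) 0 0 Hv.
  by rewrite -[RHS]E intrN; ring.
by apply/eqP/colP; apply: ord2P; rewrite mxE.
Qed.

Lemma int_lt1 (R : realType) (n : int) : `|n%:~R : R| < 1 -> n = 0.
Proof.
move=> h; apply/eqP; apply: contraT => n0; move: h.
by rewrite ltNge -intr_norm ler1z -gtz0_ge1 normr_gt0 n0.
Qed.

(* On the hyperplane the form v.x equals a combination of the two errors, where
   v <> 0 by linear independence; so if Z_n X_{n+1} were small, all 2x2 integer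
   minors of z_n, z_{n+1} involving an x-coordinate would vanish. *)
Lemma hyperplane_bound (R : realType) (Theta : 'M[R]_2) z h N :
  Z_lin_indep [tuple 1; Theta 0 0; Theta 0 1; Theta 1 0; Theta 1 1] ->
  minimal_seq Theta z -> h != 0 -> (forall n, (N <= n)%N -> dot h (z n) = 0) ->
  exists2 c : R, 0 < c &
    forall n, (N <= n)%N -> c <= lnorm Theta (z n) * xnorm R (z n.+1).
Proof.
move=> Hv Hz h0 Hh.
pose a i : R := (h.1 i 0)%:~R; pose e j : R := (h.2 j 0)%:~R.
(* Eliminating y_j = L_j(x) - [lcoord Theta j z] turns h.z = 0 into v.x = e.l, where l is the vector
   of errors. If v were 0, each of its entries would be an integer relation, and h would be 0. *)
pose v i := a i + Theta 0 i * e 0 + Theta 1 i * e 1.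
have V0 : 0 < `|v 0| + `|v 1|.
  rewrite lt_def addr_ge0 // andbT paddr_eq0 // !normr_eq0; apply/negP.
  move=> /andP[/eqP v0 /eqP v1]; move/negP: h0; apply; apply/eqP.
  have [|a0 e0 _ e1 _] := @indepE R Theta (h.1 0 0) (h.2 0 0) 0 (h.2 1 0) 0 Hv.
    by rewrite -[RHS]v0 /v /a /e; ring.
  have [|a1 _ _ _ _] := @indepE R Theta (h.1 1 0) 0 (h.2 0 0) 0 (h.2 1 0) Hv.
    by rewrite -[RHS]v1 /v /a /e; ring.
  by apply: point_eq; apply: ord2P; rewrite mxE.
have dotE n : (N <= n)%N -> v 0 * xcoord R 0 (z n) + v 1 * xcoord R 1 (z n) =
    e 0 * lcoord Theta 0 (z n) + e 1 * lcoord Theta 1 (z n).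
  move=> Nn; apply/eqP; rewrite -subr_eq0; apply/eqP.
  have := congr1 (fun m : int => m%:~R : R) (Hh n Nn).
  rewrite /dot !intrD !intrM => E; rewrite -[RHS]E.
  by rewrite /v /a /e /xcoord /lcoord !lin_form2E; ring.
pose E := `|e 0| + `|e 1| + 1.
have E0 : 0 < E by rewrite /E; have := normr_ge0 (e 0); have := normr_ge0 (e 1); lra.
(* The first entry gives 2t < 1/2, which bounds the mixed minors below 1; the second gives (|v_0| +
   |v_1|) |D| <= 4Et < (|v_0| + |v_1|)/2, hence |D| < 1. *)
pose c := Num.min 4^-1 ((`|v 0| + `|v 1|) / (8 * E)).
exists c.
  by rewrite /c lt_min invr_gt0 ltr0n /= divr_gt0 // mulr_gt0.
move=> n Nn; rewrite leNgt; apply/negP; set t := _ * _ => tc.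
have t1 : t < 4^-1 by apply: lt_le_trans tc _; rewrite /c ge_min lexx.
have t2 : t * (8 * E) < `|v 0| + `|v 1|.
  by rewrite -ltr_pdivlMr ?mulr_gt0 //; apply: lt_le_trans tc _; rewrite /c ge_min lexx orbT.
have M i j := xl_minor_le n i j Hz; rewrite -/t in M.
pose D : int := (z n).1 0 0 * (z n.+1).1 1 0 - (z n.+1).1 0 0 * (z n).1 1 0.
have DE : D%:~R = xcoord R 0 (z n) * xcoord R 1 (z n.+1) -
                  xcoord R 0 (z n.+1) * xcoord R 1 (z n).
  by rewrite /D intrB !intrM.
have F1 := dotE n Nn; have F2 := dotE n.+1 (leqW Nn).
(* Cramer's rule for the equations [dotE] at n and n+1. *)
have vD0 : v 0 * D%:~R = - (e 0 * xl_minor Theta 1 0 (z n) (z n.+1) +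
    e 1 * xl_minor Theta 1 1 (z n) (z n.+1)).
  transitivity ((v 0 * xcoord R 0 (z n) + v 1 * xcoord R 1 (z n)) * xcoord R 1 (z n.+1)
     - (v 0 * xcoord R 0 (z n.+1) + v 1 * xcoord R 1 (z n.+1)) * xcoord R 1 (z n)).
    by rewrite DE; ring.
  by rewrite F1 F2 /xl_minor; ring.
have vD1 : v 1 * D%:~R = e 0 * xl_minor Theta 0 0 (z n) (z n.+1) +
    e 1 * xl_minor Theta 0 1 (z n) (z n.+1).
  transitivity ((v 0 * xcoord R 0 (z n.+1) + v 1 * xcoord R 1 (z n.+1)) * xcoord R 0 (z n)
     - (v 0 * xcoord R 0 (z n) + v 1 * xcoord R 1 (z n)) * xcoord R 0 (z n.+1)).
    by rewrite DE; ring.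
  by rewrite F1 F2 /xl_minor; ring.
have B i : `|e 0 * xl_minor Theta i 0 (z n) (z n.+1) +
    e 1 * xl_minor Theta i 1 (z n) (z n.+1)| <= E * (2 * t).
  apply: le_trans (ler_normD _ _) _; rewrite !normrM.
  have := ler_wpM2l (normr_ge0 (e 0)) (M i 0).
  have := ler_wpM2l (normr_ge0 (e 1)) (M i 1).
  have : 0 <= t by rewrite mulr_ge0 ?lnorm_ge0 ?xnorm_ge0.
  rewrite /E; lra.
have D0 : D = 0.
  apply: (@int_lt1 R).
  have B0 := B 0; rewrite -vD1 normrM in B0.
  have B1 := B 1; rewrite -normrN -vD0 normrM in B1.
  rewrite -(ltr_pM2l V0) mulr1; lra.
(* Since D = 0, the contributions of [Theta] to the mixed minor cancel, and what remains is an
   integer of absolute value below 1. *)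
have xy i j : (z n).1 i 0 * (z n.+1).2 j 0 = (z n.+1).1 i 0 * (z n).2 j 0.
  apply/eqP; rewrite -subr_eq0; apply/eqP; apply: (@int_lt1 R).
  suff -> : ((z n).1 i 0 * (z n.+1).2 j 0 - (z n.+1).1 i 0 * (z n).2 j 0)%:~R =
      - xl_minor Theta i j (z n) (z n.+1).
    by rewrite normrN; apply: le_lt_trans (M i j) _; lra.
  move/eqP: DE; rewrite D0 eq_sym subr_eq0 => /eqP DE.
  rewrite intrB !intrM /xl_minor /lcoord !lin_form2E -/(xcoord R i _) -/(xcoord R i _).
  have XX k : xcoord R i (z n) * xcoord R k (z n.+1) = xcoord R i (z n.+1) * xcoord R k (z n).
    move: i k; apply: ord2P; apply: ord2P => //; first by rewrite mulrC.
      by rewrite mulrC -DE mulrC.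
    by rewrite mulrC.
  have := XX 0; have := XX 1; rewrite /xcoord => e1 e0.
  rewrite !mulrBr !mulrDr ![_ * (Theta _ _ * _)]mulrCA e1 e0; ring.
have [i Hi] := xnorm_witness R (z n.+1).
have xi0 : (z n.+1).1 i 0 != 0.
  rewrite -(intr_eq0 R) -normr_gt0 Hi.
  exact: le_lt_trans (xnorm_ge0 _ _) (minimal_x Hz n).
have [] := @minimal_indep2 R Theta z n ((z n.+1).1 i 0) ((z n).1 i 0) Hz.
  have D00 : (z n).1 0 0 * (z n.+1).1 1 0 = (z n.+1).1 0 0 * (z n).1 1 0.
    by apply/eqP; rewrite -subr_eq0 -/D D0.
  apply: point_eq => k; rewrite /= !mxE ?xy //.
  move: i k {Hi xi0}; apply: ord2P; apply: ord2P => /=; lia.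
by move/eqP; rewrite (negbTE xi0).
Qed.

(** * Distance to the nearest integer and heights *)

Lemma dist_int_le (R : realType) (t : R) (k : int) : dist_int t <= `|t - k%:~R|.
Proof.
apply: ge_inf; last by exists k.
by exists 0 => _ [m _ <-]; exact: normr_ge0.
Qed.

(** The infimum is attained by rounding: any other integer is at distance at least 1 - 1/2 from
    t. *)
Lemma dist_int_witness (R : realType) (t : R) :
  exists k : int, dist_int t = `|t - k%:~R| /\ dist_int t <= 2^-1.
Proof.
have [k Hk] := nearest_int t; exists k.
have E : dist_int t = `|t - k%:~R|.
  apply: le_anti; rewrite dist_int_le /=; apply: lb_le_inf; first by exists `|t - k%:~R|, k.
  move=> _ [m _ <-]; have [<-//|mk] := eqVneq m k.
  have : 1 <= `|(m - k)%:~R : R| by rewrite -intr_norm ler1z -gtz0_ge1 normr_gt0 subr_eq0.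
  have -> : (m - k)%:~R = (t - k%:~R) - (t - m%:~R) :> R by rewrite intrB; ring.
  by have := ler_normB (t - k%:~R) (t - m%:~R); lra.
by split=> //; rewrite E.
Qed.

Lemma dist_int_ge0 (R : realType) (t : R) : 0 <= dist_int t.
Proof. by have [k [-> _]] := dist_int_witness t. Qed.

Lemma max_dist2E (R : realType) (Theta : 'M[R]_2) x :
  max_dist Theta x =
    Num.max (dist_int (lin_form Theta 0 x)) (dist_int (lin_form Theta 1 x)).
Proof.
rewrite /max_dist !big_ord_recl big_ord0 (max_l (dist_int_ge0 _)).
by congr (Num.max _ (dist_int (lin_form _ _ _))); apply: val_inj.
Qed.

Lemma height2E (x : 'cV[int]_2) : height x = Num.max `|x 0 0| `|x 1 0|.
Proof.
rewrite /height !big_ord_recl big_ord0 (max_l (normr_ge0 _)).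
by congr (Num.max _ `|x _ _|); apply: val_inj.
Qed.

Definition nheight (z : ipoint) : nat := maxn (absz (z.1 0 0)) (absz (z.1 1 0)).

Lemma xnormE (R : realType) (z : ipoint) : xnorm R z = (nheight z)%:R.
Proof.
rewrite /xnorm /nheight /xcoord -!intr_norm.
by rewrite -!natr_absz -natr_max.
Qed.

Lemma xnorm_height (R : realType) (z : ipoint) : xnorm R z = (height z.1)%:~R.
Proof.
rewrite height2E /xnorm /xcoord -!intr_norm.
by case: (leP `|z.1 0 0| `|z.1 1 0|) => h; [apply: max_r|apply: max_l];
  rewrite ler_int // ltW.
Qed.

Lemma height_gt0 (x : 'cV[int]_2) : (0 < height x) = (x != 0).
Proof.
rewrite height2E lt_max !normr_gt0; apply/idP/idP.
  by apply: contraTN => /eqP ->; rewrite !mxE eqxx.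
apply: contraNT; rewrite negb_or !negbK => /andP[/eqP h0 /eqP h1].
by apply/eqP/colP; apply: ord2P; rewrite mxE.
Qed.

Lemma max_dist_le (R : realType) (Theta : 'M[R]_2) (z : ipoint) :
  max_dist Theta z.1 <= lnorm Theta z.
Proof.
rewrite max_dist2E ge_max; apply/andP; split.
- exact: le_trans (dist_int_le _ (z.2 0 0)) (le_lcoord Theta 0 z).
- exact: le_trans (dist_int_le _ (z.2 1 0)) (le_lcoord Theta 1 z).
Qed.

Lemma max_dist_witness (R : realType) (Theta : 'M[R]_2) x :
  exists z : ipoint, [/\ z.1 = x, lnorm Theta z = max_dist Theta x
    & lnorm Theta z <= 2^-1].
Proof.
have [k0 [E0 h0]] := dist_int_witness (lin_form Theta 0 x).
have [k1 [E1 h1]] := dist_int_witness (lin_form Theta 1 x).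
have E : lnorm Theta (x, \col_i (if i == 0 then k0 else k1)) = max_dist Theta x.
  by rewrite max_dist2E /lnorm /lcoord /= !mxE /= -E0 -E1.
exists (x, \col_i (if i == 0 then k0 else k1)); split=> //.
by rewrite E max_dist2E ge_max h0 h1.
Qed.

(** * Dirichlet's theorem and the construction of minimal points *)

(** Pigeonhole: the fractional parts of the two forms at the (N+1)^2 points of [0, N]^2 fall into
    N^2 boxes of side 1/N. *)
Lemma dirichlet (R : realType) (Theta : 'M[R]_2) (N : nat) : (0 < N)%N ->
  exists z : ipoint, [/\ z.1 != 0, xnorm R z <= N%:R & lnorm Theta z <= N%:R^-1].
Proof.
case: N => // M _; set N := M.+1.
have N0 : 0 < N%:R :> R by rewrite ltr0n.
pose t j (p : 'I_N.+1 * 'I_N.+1) : R := Theta j 0 * p.1%:R + Theta j 1 * p.2%:R.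
pose fr j p : R := t j p - (Num.floor (t j p))%:~R.
have fr01 j p : 0 <= fr j p < 1.
  have /andP[h1 h2] := floor_itv (t j p); rewrite intrD in h2.
  by rewrite /fr subr_ge0 h1 ltrBlDl.
pose cell j p : int := Num.floor (N%:R * fr j p).
have cell0 j p : 0 <= cell j p.
  by rewrite /cell floor_ge0 mulr_ge0 //; case/andP: (fr01 j p).
have cellN j p : (`|cell j p| < N)%N.
  rewrite -ltz_nat gez0_abs // /cell -(ltr_int R); apply: le_lt_trans (floor_le _) _.
  by rewrite -[X in _ < X]mulr1 ltr_pM2l //; case/andP: (fr01 j p).
pose f p : 'I_N * 'I_N := (Ordinal (cellN 0 p), Ordinal (cellN 1 p)).
have /injectivePn [p [q pq fpq]] : ~~ injectiveb f.
  apply/negP => /injectiveP /leq_card.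
  by rewrite !card_prod !card_ord; nia.
have Ec j : cell j p = cell j q.
  move: fpq => [h0 h1]; rewrite -[LHS]gez0_abs // -[RHS]gez0_abs //; congr Posz.
  by move: j; apply: ord2P.
pose x : 'cV[int]_2 := \col_i (if i == 0 then (p.1 : nat)%:Z - (q.1 : nat)%:Z
                                else (p.2 : nat)%:Z - (q.2 : nat)%:Z).
pose z : ipoint := (x, \col_j (Num.floor (t j p) - Num.floor (t j q))).
exists z; split.
- apply: contra pq => /eqP /colP h; have := h 0; have := h 1; rewrite !mxE /=.
  move=> h1 h0; apply/eqP; case: (p) (q) h0 h1 => [p1 p2] [q1 q2] /= h0 h1.
  by congr pair; apply: val_inj => /=; lia.
- rewrite xnormE ler_nat /nheight /= !mxE /=.
  have := ltn_ord p.1; have := ltn_ord p.2; have := ltn_ord q.1; have := ltn_ord q.2.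
  rewrite !ltnS => h1 h2 h3 h4.
  move: (q.2 : nat) (q.1 : nat) (p.2 : nat) (p.1 : nat) h1 h2 h3 h4.
  move=> a b c d h1 h2 h3 h4.
  by rewrite geq_max; apply/andP; split; lia.
- apply: ltW; apply: lnorm_lt => j.
  have -> : lcoord Theta j z = fr j p - fr j q.
    rewrite /lcoord lin_form2E /= !mxE /= /fr /t !intrB; ring.
  have /andP[a1 a2] := floor_itv (N%:R * fr j p).
  have /andP[b1 b2] := floor_itv (N%:R * fr j q).
  move: a1 a2 b1 b2; rewrite !intrD -/(cell j p) -/(cell j q) Ec => a1 a2 b1 b2.
  rewrite -(ltr_pM2l N0) mulfV ?gt_eqF // -[X in X * `|_|]gtr0_norm // -normrM.
  rewrite mulrBr ltr_norml; apply/andP; split; lra.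
Qed.

(** The errors of such a point are integers, so it never competes with a point of error at most
    1/2. *)
Lemma lnorm_ge1 (R : realType) (Theta : 'M[R]_2) (u : ipoint) :
  u != 0 -> u.1 = 0 -> 1 <= lnorm Theta u.
Proof.
case: u => [u1 u2] /= u0 E; rewrite E in u0 *.
have H j : u2 j 0 != 0 -> 1 <= lnorm Theta (0, u2).
  move=> h; apply: le_trans (le_lcoord Theta j _).
  rewrite /lcoord lin_form2E /= !mxE !mulr0 !add0r normrN -intr_norm ler1z.
  by rewrite -gtz0_ge1 normr_gt0.
have [h0|/H //] := eqVneq (u2 0 0) 0; have [h1|/H //] := eqVneq (u2 1 0) 0.
move/negP: u0; case; apply/eqP; congr pair; apply/colP; apply: ord2P; by rewrite mxE.
Qed.

(** Only the x-part ranges over a finite box, encoded by indices up to 2N shifted by N; the best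
    y-part is found by rounding. *)
Lemma exists_minimizer (R : realType) (Theta : 'M[R]_2) (N : nat) : (0 < N)%N ->
  exists z : ipoint, [/\ z.1 != 0, xnorm R z <= N%:R, lnorm Theta z <= 2^-1 &
    forall u, u != 0 -> xnorm R u <= N%:R -> lnorm Theta z <= lnorm Theta u].
Proof.
move=> N0; pose K := (2 * N)%N.
pose g (p : 'I_K.+1 * 'I_K.+1) : 'cV[int]_2 :=
  \col_i (if i == 0 then (p.1 : nat)%:Z - N%:Z else (p.2 : nat)%:Z - N%:Z).
have gle p : (height (g p))%:~R <= N%:R :> R.
  have -> : height (g p) = height (g p, 0 : 'cV[int]_2).1 by [].
  rewrite -xnorm_height xnormE ler_nat /nheight /= !mxE /=.
  have := ltn_ord p.1; have := ltn_ord p.2; rewrite /K !ltnS; lia.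
have gsurj (x : ipoint) : xnorm R x <= N%:R -> exists p, g p = x.1.
  rewrite xnormE ler_nat /nheight => h.
  exists (inord `|x.1 0 0 + N|, inord `|x.1 1 0 + N|).
  apply/colP; apply: ord2P; rewrite mxE /= inordK /K; lia.
have [d [d0 dN _]] := dirichlet Theta N0.
have [p0 Hp0] := gsurj d dN.
have Pp0 : g p0 != 0 by rewrite Hp0.
case: (@Order.TotalTheory.arg_minP _ R _ p0 (fun p => g p != 0)
  (fun p => max_dist Theta (g p)) Pp0) => p Pp Hp.
have [z [z1 zE z2]] := max_dist_witness Theta (g p).
exists z; split=> //; first by rewrite z1.
  by rewrite xnorm_height z1.
move=> u u0 uN; have [h|h] := eqVneq u.1 0.
  by have := lnorm_ge1 Theta u0 h; lra.
have [q Hq] := gsurj u uN.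
apply: le_trans (max_dist_le Theta u); rewrite zE -Hq; apply: Hp; by rewrite Hq.
Qed.

Definition best (R : realType) (Theta : 'M[R]_2) (z : ipoint) : Prop :=
  [/\ z.1 != 0, lnorm Theta z <= 2^-1 &
    forall u, u != 0 -> xnorm R u <= xnorm R z -> lnorm Theta z <= lnorm Theta u].

(** [z'] minimises the error up to the least height [n] at which a nonzero point beats [z], so its
    height is exactly [n]. Such a height exists by Dirichlet, the error of [z] being positive by
    linear independence. *)
Lemma best_next (R : realType) (Theta : 'M[R]_2) (z : ipoint) :
  Z_lin_indep [tuple 1; Theta 0 0; Theta 0 1; Theta 1 0; Theta 1 1] ->
  best Theta z -> exists z', [/\ best Theta z', xnorm R z < xnorm R z',
    lnorm Theta z' < lnorm Theta z & forall u, u != 0 -> xnorm R u < xnorm R z' ->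
      lnorm Theta z <= lnorm Theta u].
Proof.
move=> Hv [z0 z2 zmin].
have l0 : 0 < lnorm Theta z.
  by apply: lt_le_trans (le_lcoord Theta 0 z); rewrite normr_gt0 lcoord_neq0.
pose P (n : nat) := `[< exists u : ipoint, [/\ u != 0, nheight u = n &
  lnorm Theta u < lnorm Theta z] >].
have exP : exists n, P n.
  have [u [u0 _ ul]] := dirichlet Theta (ltn0Sn (Num.truncn (lnorm Theta z)^-1)).
  exists (nheight u); apply/asboolP; exists u; split=> //.
    by apply: contra u0 => /eqP ->.
  apply: le_lt_trans ul _; rewrite invf_plt ?posrE ?ltr0n //.
  by apply: truncnS_gt.
case: (ex_minnP exP) => n /asboolP [w [w0 wn wl]] nmin.
have nz : (nheight z < n)%N.
  rewrite ltnNge; apply/negP => h; have := zmin w w0.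
  by rewrite !xnormE ler_nat wn h => /(_ isT); rewrite leNgt wl.
have [z' [z'0 z'x z'2 z'min]] := exists_minimizer Theta (leq_trans (ltn0Sn _) nz).
have z'l : lnorm Theta z' < lnorm Theta z.
  by apply: le_lt_trans wl; apply: z'min => //; rewrite xnormE wn.
have z'n : nheight z' = n.
  apply/eqP; rewrite eqn_leq -(ler_nat R) -xnormE z'x /=; apply: nmin.
  apply/asboolP; exists z'; split=> //; by apply: contra z'0 => /eqP ->.
exists z'; split=> //.
- by split=> // u u0; rewrite (xnormE R z') z'n; exact: z'min.
- by rewrite !xnormE ltr_nat z'n.
- move=> u u0; rewrite !xnormE ltr_nat z'n => un; rewrite leNgt; apply/negP => ul.
  have := nmin (nheight u); rewrite leqNgt un => h.
  by have : false by apply: h; apply/asboolP; exists u.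
Qed.

Lemma exists_minimal_seq (R : realType) (Theta : 'M[R]_2) :
  Z_lin_indep [tuple 1; Theta 0 0; Theta 0 1; Theta 1 0; Theta 1 1] ->
  exists z, minimal_seq Theta z /\ forall n, (z n).1 != 0.
Proof.
move=> Hv.
pose S := {z | best Theta z}.
have [f Hf] : exists f : S -> S, forall s,
   [/\ xnorm R (sval s) < xnorm R (sval (f s)),
    lnorm Theta (sval (f s)) < lnorm Theta (sval s) &
    forall u, u != 0 -> xnorm R u < xnorm R (sval (f s)) ->
      lnorm Theta (sval s) <= lnorm Theta u].
  have next (s : S) : exists s' : S, [/\ xnorm R (sval s) < xnorm R (sval s'),
    lnorm Theta (sval s') < lnorm Theta (sval s) &
    forall u, u != 0 -> xnorm R u < xnorm R (sval s') ->
      lnorm Theta (sval s) <= lnorm Theta u].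
    case: s => z Hz.
    by have [z' [b h1 h2 h3]] := best_next Hv Hz; exists (exist _ z' b).
  by exists (fun s => projT1 (cid (next s))) => s; case: (cid (next s)).
have [z0 [z01 z0x z02 z0min]] := @exists_minimizer R Theta 1 isT.
have b0 : best Theta z0.
  by split=> // u u0 ux; apply: z0min => //; exact: le_trans ux z0x.
exists (fun n => sval (iter n f (exist _ z0 b0))); split; last first.
  by move=> n; case: (iter n _ _) => z [].
by split=> n /=; have [] := Hf (iter n f (exist _ z0 b0)).
Qed.

(** * The function psi, limits at infinity and a real inequality *)

Lemma max_dist_ge0 (R : realType) (Theta : 'M[R]_2) x : 0 <= max_dist Theta x.
Proof. by rewrite max_dist2E le_max dist_int_ge0. Qed.

Lemma psi_le (R : realType) (Theta : 'M[R]_2) (z : ipoint) (t : R) :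
  z.1 != 0 -> xnorm R z <= t -> psi Theta t <= lnorm Theta z.
Proof.
move=> z0 zt; apply: le_trans (max_dist_le Theta z); apply: ge_inf.
  by exists 0 => _ [x _ <-]; exact: max_dist_ge0.
by exists z.1 => //=; rewrite height_gt0 z0 -xnorm_height.
Qed.

Lemma psi_ge (R : realType) (Theta : 'M[R]_2) (t B : R) : 1 <= t ->
  (forall z : ipoint, z.1 != 0 -> xnorm R z <= t -> B <= lnorm Theta z) ->
  B <= psi Theta t.
Proof.
move=> t1 H; apply: lb_le_inf.
  have [z [z0 zx _]] := @dirichlet R Theta 1 isT.
  exists (max_dist Theta z.1), z.1 => //=.
  by rewrite height_gt0 z0 -xnorm_height (le_trans zx).
move=> _ [x /= [x0 xt] <-].
have [z [zx <- _]] := max_dist_witness Theta x.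
by apply: H; [rewrite zx -height_gt0|rewrite xnorm_height zx].
Qed.

Lemma psi_ge0 (R : realType) (Theta : 'M[R]_2) (t : R) : 1 <= t -> 0 <= psi Theta t.
Proof. by move=> t1; apply: psi_ge => // z _ _; exact: lnorm_ge0. Qed.

(** For N the integer part of t, psi(t) <= 1/N and t <= 2N. *)
Lemma psi_dirichlet (R : realType) (Theta : 'M[R]_2) (t : R) :
  1 <= t -> t * psi Theta t <= 2.
Proof.
move=> t1; pose N := Num.truncn t.
have /andP[Nt tN] := truncn_itv (le_trans ler01 t1); rewrite -/N in Nt tN.
have N0 : (0 < N)%N by rewrite /N truncn_gt0.
have [z [z0 zx zl]] := dirichlet Theta N0.
have := psi_le Theta z0 (le_trans zx Nt) => h.
have N0' : 0 < N%:R :> R by rewrite ltr0n.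
have t2 : t <= 2 * N%:R.
  apply: ltW (lt_le_trans tN _); rewrite -natrM ler_nat; lia.
have := ler_pM (le_trans ler01 t1) (psi_ge0 Theta t1) t2 (le_trans h zl).
by rewrite -mulrA mulfV ?gt_eqF // mulr1.
Qed.

Lemma limf_esup_lty (R : realType) (f : R -> R) :
  (limf_esup (EFin \o f) (pinfty_nbhs R) < +oo)%E <->
  exists C M, forall t, M < t -> f t <= C.
Proof.
rewrite limf_esupE; split.
- move=> /ereal_inf_lt [_ [V [M [_ HM]] <-] VC].
  have [C hC] : exists C : R, (ereal_sup ((EFin \o f) @` V) <= C%:E)%E.
    move: VC; case: (ereal_sup _) => [r _| |_] //; first by exists r.
    by exists 0; rewrite leNye.
  exists C, M => t Mt; rewrite -lee_fin; apply: le_trans hC.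
  by apply: ereal_sup_ubound; exists t => //; apply: HM.
- move=> [C [M H]]; apply: (@le_lt_trans _ _ C%:E); last exact: ltry.
  apply: (@le_trans _ _ (ereal_sup ((EFin \o f) @` [set t | M < t]))).
    apply: ereal_inf_lbound; exists [set t | M < t] => //.
    by exists M; split; [exact: num_real|].
  by apply: ge_ereal_sup => _ [t Mt <-]; rewrite lee_fin H.
Qed.

Lemma limf_einf_lty (R : realType) (f : R -> R) :
  ~ (limf_einf (EFin \o f) (pinfty_nbhs R) < +oo)%E ->
  forall C, exists M, forall t, M < t -> C <= f t.
Proof.
move=> /negP; rewrite -leNgt limf_einfE => H C.
have /ereal_sup_gt [_ [V [M [_ HM]] <-] CV] := lt_le_trans (ltry C) H.
exists M => t Mt; rewrite -lee_fin; apply: le_trans (ltW CV) _.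
by apply: ereal_inf_lbound; exists t => //; apply: HM.
Qed.

(* Here p, q, r stand for ln X_{n+1}, ln X_{k+1}, ln X_{k+2}. *)
Lemma log_ineq (R : realType) (g b K : R) : 1 < g -> g <= b ->
  b ^+ 2 + (g - 1) * b - g * (2 * g ^+ 2 - 2 * g + 1) < 0 ->
  exists P : R, forall p q r, P < p -> p <= q -> g * r <= b * q + K ->
    g * p + (g - 1) * q <= r + K -> (g - 1) * q <= (b - 1) * p + K -> False.
Proof.
(* Eliminating r leaves g^2 p <= s q + O(1); if s > 0, eliminating q leaves D p <= O(1). *)
move=> g1 gb F; pose s := b - g ^+ 2 + g; pose D := g ^+ 2 * (g - 1) - s * (b - 1).
have D0 : 0 < D.
  have -> : D = - (b ^+ 2 + (g - 1) * b - g * (2 * g ^+ 2 - 2 * g + 1)) +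
      g ^+ 2 * (b - g) by rewrite /D /s; ring.
  by rewrite ltr_wpDr ?oppr_gt0 // mulr_ge0 ?sqr_ge0 // subr_ge0.
(* p > A refutes the case s <= 0, and p > B the case s > 0. *)
pose A := `|(K + g * K) / g ^+ 2|; pose B := `|(s * K + (g - 1) * (K + g * K)) / D|.
have A0 : 0 <= A by exact: normr_ge0. have B0 : 0 <= B by exact: normr_ge0.
have g2 : 0 < g ^+ 2 by rewrite exprn_gt0 // (lt_trans ltr01).
exists (A + B) => p q r Pp pq h1 h2 h3.
have hA : K + g * K < g ^+ 2 * p.
  rewrite [X in _ < X]mulrC -ltr_pdivrMr //; apply: le_lt_trans (ler_norm _) _; rewrite -/A; lra.
have hB : s * K + (g - 1) * (K + g * K) < D * p.
  rewrite [X in _ < X]mulrC -ltr_pdivrMr //; apply: le_lt_trans (ler_norm _) _; rewrite -/B; lra.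
have h4 : g ^+ 2 * p - (K + g * K) <= s * q.
  have := ler_wpM2l (ltW (lt_trans ltr01 g1)) h2; rewrite /s; nra.
have [s0|s0] := lerP s 0.
  have : s * q <= 0 by apply: mulr_le0_ge0 => //; lra.
  lra.
have h5 := ler_wpM2l (ltW s0) h3.
have g10 : 0 <= g - 1 by lra.
have h6 := ler_wpM2l g10 h4.
move: hB h5 h6; rewrite /D; nra.
Qed.

(** * Estimates along the minimal sequence and the contradiction *)

Lemma xnorm_ge (R : realType) (Theta : 'M[R]_2) z n :
  minimal_seq Theta z -> n%:R <= xnorm R (z n).
Proof.
move=> Hz; elim: n => [|n IH]; first exact: xnorm_ge0.
have := minimal_x Hz n; move: IH; rewrite !xnormE ltr_nat !ler_nat.
exact: leq_ltn_trans.
Qed.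

Lemma xnorm_mono (R : realType) (Theta : 'M[R]_2) z n k :
  minimal_seq Theta z -> (n <= k)%N -> xnorm R (z n) <= xnorm R (z k).
Proof.
move=> Hz /subnKC <-; elim: (k - n)%N => [|d IH]; first by rewrite addn0.
by rewrite addnS; apply: le_trans IH (ltW (minimal_x Hz _)).
Qed.

Lemma lnorm_mono (R : realType) (Theta : 'M[R]_2) z n k :
  minimal_seq Theta z -> (n <= k)%N -> lnorm Theta (z k) <= lnorm Theta (z n).
Proof.
move=> Hz /subnKC <-; elim: (k - n)%N => [|d IH]; first by rewrite addn0.
by rewrite addnS; apply: le_trans (ltW (minimal_l Hz _)) IH.
Qed.

(** Here g is admissible for alpha and b is not admissible for beta; the quadratic inequality says
    that b < g g_3(g). *)
Lemma exponents_contra (R : realType) (Theta : 'M[R]_2) (g b C M : R) :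
  Z_lin_indep [tuple 1; Theta 0 0; Theta 0 1; Theta 1 0; Theta 1 1] ->
  1 < g -> g <= b ->
  b ^+ 2 + (g - 1) * b - g * (2 * g ^+ 2 - 2 * g + 1) < 0 ->
  (forall t, M < t -> t `^ g * psi Theta t <= C) ->
  (forall t, M < t -> 1 <= t `^ b * psi Theta t) -> False.
Proof.
move=> Hv g1 gb F HC Hb.
have [z [Hz z0]] := exists_minimal_seq Hv.
pose X n := xnorm R (z n); pose L n := lnorm Theta (z n).
have X1 n : 1 <= X n.
  rewrite /X xnorm_height ler1z -gtz0_ge1 height_gt0; exact: z0.
have L0 n : 0 < L n.
  by apply: lt_le_trans (le_lcoord Theta 0 _); rewrite normr_gt0 lcoord_neq0.
have X0 n : 0 < X n by apply: lt_le_trans (X1 n).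
have XS n : X n + 1 <= X n.+1.
  have := minimal_x Hz n; rewrite /X !xnormE ltr_nat => h.
  by rewrite natr1 ler_nat.
pose p n := ln (X n); pose l n := ln (L n).
have p0 n : 0 <= p n by rewrite ln_ge0.
have pmono n k : (n <= k)%N -> p n <= p k.
  by move=> nk; rewrite ler_ln ?posrE //; apply: xnorm_mono Hz nk.
have plarge P : exists N, forall n, (N <= n)%N -> P < p n.
  exists (Num.truncn (expR P)).+1 => n Nn; rewrite -ltr_expR lnK ?posrE //.
  apply: lt_le_trans (xnorm_ge n Hz); apply: lt_le_trans (truncnS_gt _) _.
  by rewrite ler_nat.
(* The lower bound forces psi > 0, hence C > 0, so that ln C is meaningful. *)
have C0 : 0 < C.
  pose t := Num.max 1 (M + 1).
  have Mt : M < t by rewrite /t lt_max; apply/orP; right; lra.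
  have t1 : 1 <= t by rewrite /t le_max lexx.
  have h2 := Hb t Mt; apply: lt_le_trans (HC t Mt).
  rewrite mulr_gt0 ?powR_gt0 //; first lra.
  rewrite lt_def psi_ge0 // andbT; apply/eqP => E; move: h2; rewrite E mulr0; lra.
pose K1 := ln C + g * ln 2.
have [N0 HN0] : exists N, forall n, (N <= n)%N -> M < X n.
  exists (Num.truncn `|M|).+1 => n Nn.
  apply: lt_le_trans (xnorm_ge n Hz); apply: le_lt_trans (ler_norm M) _.
  by apply: lt_le_trans (truncnS_gt _) _; rewrite ler_nat.
have up n : (N0 <= n)%N -> g * p n.+1 + l n <= K1.
  move=> Nn; have h1 := HN0 n Nn; have h2 := XS n; have h3 := X1 n.
  (* Minimality concerns heights strictly below X_{n+1}. Since t >= X_n >= 1, also t >= X_{n+1}/2,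
     which costs the term g ln 2 in [K1]. *)
  pose t := X n.+1 - 1.
  have t1 : 1 <= t by rewrite /t; lra.
  have Lt : L n <= psi Theta t.
    apply: psi_ge => // u u0 ut; apply: (minimal_min Hz).
      by apply: contra u0 => /eqP ->.
    by apply: le_lt_trans ut _; rewrite /t -/(X n.+1); lra.
  have t0 : 0 < t by lra.
  have h4 : t `^ g * L n <= C.
    apply: le_trans (HC t _); first by rewrite ler_wpM2l // powR_ge0.
    by rewrite /t; lra.
  have := h4; rewrite -ler_ln ?posrE ?mulr_gt0 ?powR_gt0 // lnM ?posrE ?powR_gt0 //.
  rewrite ln_powR -/(l n) => h5.
  have h6 : p n.+1 <= ln 2 + ln t.
    by rewrite -lnM ?posrE // /p ler_ln ?posrE // ?mulr_gt0 // /t; lra.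
  have := ler_wpM2l (ltW (lt_trans ltr01 g1)) h6; rewrite /K1; lra.
have low n : (N0 <= n)%N -> 0 <= b * p n + l n.
  move=> Nn; have h1 := Hb _ (HN0 n Nn).
  have h2 : 1 <= X n `^ b * L n.
    by apply: le_trans h1 _; rewrite ler_wpM2l ?powR_ge0 //; apply: psi_le.
  have := h2; rewrite -ler_ln ?posrE ?mulr_gt0 ?powR_gt0 // ln1.
  by rewrite lnM ?posrE ?powR_gt0 // ln_powR.
(* A tail in a hyperplane would give ln c <= l_n + p_{n+1} <= K1 - (g - 1) p_{n+1}, impossible for
   large n as g > 1. *)
have Hh h n0 : h != 0 -> exists2 n, (n0 <= n)%N & dot h (z n) != 0.
  move=> h0; apply: contrapT => Hn.
  have [|c c0 Hc] := @hyperplane_bound R Theta z h n0 Hv Hz h0.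
    by move=> n nn; apply/eqP; apply: contraT => hn; case: Hn; exists n.
  have [N1 HN1] := plarge (`|K1 - ln c| / (g - 1)).
  pose n := maxn n0 (maxn N0 N1).
  have hn1 : (n0 <= n)%N by rewrite /n; lia.
  have hn2 : (N0 <= n)%N by rewrite /n; lia.
  have hn3 : (N1 <= n.+1)%N by rewrite /n; lia.
  have h0' : c <= L n * X n.+1 := Hc n hn1.
  move: h0'; rewrite -ler_ln ?posrE ?mulr_gt0 // lnM ?posrE //.
  rewrite -/(l n) -/(p n.+1) => h1; have h2 := up n hn2.
  have := HN1 n.+1 hn3; rewrite ltr_pdivrMr ?subr_gt0 // => h3.
  have := ler_norm (K1 - ln c); lra.
pose K := `|K1| + `|ln 24 + 2 * K1| + `|ln 8 + K1|.
have [P HP] := @log_ineq R g b K g1 gb F.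
have [N1 HN1] := plarge P.
have [n [k [Nn nk Hc Hd]]] := exists_transition (maxn N0 N1) Hz Hh.
have e1 := up n (leq_trans (leq_maxl _ _) Nn).
have nk1 : (N0 <= k)%N by lia.
have e2 := up k nk1; have e3 := up k.+1 (leqW nk1).
have e4 := low k.+1 (leqW nk1).
have e5 : 0 <= b * p n.+1 + l n.+1 by apply: low; lia.
have a1 : l n.+1 + p n.+2 <= ln 8 + (l k + p k.+1).
  have := @coplanar_range R Theta z n.+1 k Hz nk Hc.
  move=> h; have : L n.+1 * X n.+2 <= 8 * (L k * X k.+1) := h.
  rewrite -ler_ln ?posrE ?mulr_gt0 //.
  by rewrite lnM ?posrE // lnM ?posrE ?mulr_gt0 // lnM ?posrE.
have a2 : 0 <= ln 24 + (l n + l k + (p k.+1 + p k.+2)).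
  have := le_trans (det_point_mx_ge1 R Hd) (det_point_mx_le
    (xnorm_mono Hz (ltnW nk)) (ltW (minimal_x Hz k)) (ltW (minimal_x Hz k.+1))
    (ltW (minimal_l Hz k.+1)) (ltW (minimal_l Hz k)) (lnorm_mono Hz (ltnW nk))).
  move=> h; have : 1 <= 24 * (L n * L k * (X k.+1 * X k.+2)) := h.
  rewrite -ler_ln ?posrE ?mulr_gt0 // ln1.
  by rewrite lnM ?posrE ?mulr_gt0 // lnM ?posrE ?mulr_gt0 // lnM ?posrE // lnM ?posrE.
have m1 := pmono n.+1 n.+2 (leqnSn _).
have m2 : p n.+1 <= p k.+1 by apply: pmono; rewrite ltnS ltnW.
have k1 := ler_norm K1; have k2 := ler_norm (ln 24 + 2 * K1).
have k3 := ler_norm (ln 8 + K1).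
have k4 := normr_ge0 K1; have k5 := normr_ge0 (ln 24 + 2 * K1).
have k6 := normr_ge0 (ln 8 + K1).
(* The three inequalities come, in order, from [e3] and [e4]; from [a2] with [e1] and [e2]; and from
   [a1] with [e2], [e5] and [m1]. *)
apply: (HP (p n.+1) (p k.+1) (p k.+2)) => //.
- exact: HN1 (leqW (leq_trans (leq_maxr _ _) Nn)).
- rewrite /K; lra.
- rewrite /K; lra.
- rewrite /K; lra.
Qed.

(** * The exponents and the function g_3 *)

Lemma uniform_exponent_ge1 (R : realType) (Theta : 'M[R]_2) :
  (1%:E <= uniform_exponent Theta)%E.
Proof.
apply: ereal_sup_ubound; exists 1 => //; split=> //.
apply/limf_esup_lty; exists 2, 1 => t t1.
by rewrite powRr1 ?(le_trans ler01 (ltW t1)) // psi_dirichlet // ltW.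
Qed.

Lemma uniform_le_individual (R : realType) (Theta : 'M[R]_2) :
  (uniform_exponent Theta <= individual_exponent Theta)%E.
Proof.
apply: le_ereal_sup => _ [g [g0 Hg] <-]; exists g => //; split=> //.
apply: contrapT => /limf_einf_lty Hi.
have /limf_esup_lty [C [M H1]] := Hg.
have [M' H2] := Hi (C + 1).
have := H1 (Num.max M M' + 1); have := H2 (Num.max M M' + 1).
have h1 : M <= Num.max M M' by rewrite le_max lexx.
have h2 : M' <= Num.max M M' by rewrite le_max lexx orbT.
move=> h3 h4.
have := h3 (le_lt_trans h2 (ltr_pwDr ltr01 (lexx _))).
have := h4 (le_lt_trans h1 (ltr_pwDr ltr01 (lexx _))).
lra.
Qed.

(** a g_3(a) is the larger root of this quadratic polynomial in b. *)
Lemma lt_mul_g3 (R : realType) (a b : R) : 1 <= a -> a <= b -> b < a * g3 a ->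
  b ^+ 2 + (a - 1) * b - a * (2 * a ^+ 2 - 2 * a + 1) < 0.
Proof.
move=> a1 ab; rewrite /g3; set D := _ ^+ 2 + _.
have -> : a * ((1 - a + Num.sqrt D) / (2 * a)) = (1 - a + Num.sqrt D) / 2.
  by field; apply/eqP; lra.
move=> h; have h1 : 2 * b + a - 1 < Num.sqrt D by lra.
have D0 : 0 <= D by rewrite /D addr_ge0 ?sqr_ge0 //; nra.
have h0 : 0 <= 2 * b + a - 1 by lra.
have : (2 * b + a - 1) ^+ 2 < D by rewrite -(sqr_sqrtr D0) ltr_pXn2r ?nnegrE ?sqrtr_ge0.
rewrite /D; lra.
Qed.

(** The supremum defining alpha may not be attained, so the strict inequality has to pass to
    exponents slightly below a. The case a = 1 is excluded, since it would say b^2 < 1. *)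
Lemma exists_lower_exponent (R : realType) (a b : R) : 1 <= a -> a <= b ->
  b ^+ 2 + (a - 1) * b - a * (2 * a ^+ 2 - 2 * a + 1) < 0 ->
  exists2 d, d < a & forall g, d < g -> g <= a ->
    1 < g /\ b ^+ 2 + (g - 1) * b - g * (2 * g ^+ 2 - 2 * g + 1) < 0.
Proof.
move=> a1 ab F.
have a1' : 1 < a.
  rewrite lt_neqAle a1 andbT; apply/eqP => E.
  have : 1 <= b ^+ 2 by rewrite exprn_ege1 // (le_trans a1 ab).
  by rewrite -E in F; lra.
pose H := b ^+ 2 + (a - 1) * b - a * (2 * a ^+ 2 - 2 * a + 1).
(* A bound for the slope in g: 2(a^2 + a g + g^2) <= 6 a^2, and the remaining terms add at most
   1. *)
pose c := 6 * a ^+ 2 + 1.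
have c0 : 0 < c by rewrite /c; nra.
exists (Num.max 1 (a + H / c)).
  by rewrite gt_max a1' /= gtrDl pmulr_llt0 // invr_gt0.
move=> g; rewrite gt_max => /andP[g1 hg] ga; split=> //.
have h1 : 0 < (g - a) * c - H.
  have hc : H / c < g - a by lra.
  by rewrite subr_gt0 -ltr_pdivrMr.
have -> : b ^+ 2 + (g - 1) * b - g * (2 * g ^+ 2 - 2 * g + 1) =
  H - (a - g) * (b - (2 * (a ^+ 2 + a * g + g ^+ 2) - 2 * (a + g) + 1)).
  by rewrite /H; ring.
suff : (a - g) * (2 * (a ^+ 2 + a * g + g ^+ 2) - 2 * (a + g) + 1 - b) <= (a - g) * c by lra.
apply: ler_wpM2l; first lra.
rewrite /c; nra.
Qed.

Theorem theorem4 (R : realType) (Theta : 'M[R]_(2, 2))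
    (indep : Z_lin_indep
       [tuple 1; Theta 0 0; Theta 0 1; Theta 1 0; Theta 1 1]) :
  (uniform_exponent Theta * g3_ext (uniform_exponent Theta)
     <= individual_exponent Theta)%E.
Proof.
have U1 := uniform_exponent_ge1 Theta; have UI := uniform_le_individual Theta.
case aE : (uniform_exponent Theta) => [a| |]; last 2 first.
(* If alpha = +oo, then beta >= alpha is +oo too. *)
- by move: UI; rewrite aE leye_eq => /eqP ->.
- by move: U1; rewrite aE.
have a1 : 1 <= a by rewrite -lee_fin -aE.
rewrite /g3_ext /= -EFinM leNgt; apply/negP => Ilt.
case bE : (individual_exponent Theta) Ilt UI => [b0| |] Ilt UI //; last first.
  by move: UI; rewrite aE.
rewrite lte_fin in Ilt; have ab0 : a <= b0 by rewrite -lee_fin -aE.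
(* The midpoint lies strictly above beta, so t^b psi(t) tends to +oo, and strictly below alpha
   g_3(alpha). *)
pose b := (b0 + a * g3 a) / 2.
have b0b : b0 < b by rewrite /b; lra.
have ab : a <= b by lra.
have bG : b < a * g3 a by rewrite /b; lra.
have [d da Hd] := exists_lower_exponent a1 ab (lt_mul_g3 a1 ab bG).
have : (d%:E < uniform_exponent Theta)%E by rewrite aE lte_fin.
move=> /ereal_sup_gt [_ [g [g0 Hg] <-]]; rewrite lte_fin => dg.
have ga : g <= a by rewrite -lee_fin -aE; apply: ereal_sup_ubound; exists g.
have [g1 Fg] := Hd g dg ga.
have /limf_esup_lty [C [M HC]] := Hg.
have Hb : ~ (limf_einf (fun t : R => (t `^ b * psi Theta t)%:E) (pinfty_nbhs R)
    < +oo)%E.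
  move=> h; have : (b%:E <= individual_exponent Theta)%E.
    by apply: ereal_sup_ubound; exists b => //; split=> //; lra.
  by rewrite bE lee_fin leNgt b0b.
have [M' HM'] := limf_einf_lty Hb 1.
apply: (@exponents_contra R Theta g b C (Num.max M M')) => //.
- exact: le_trans ga ab.
- by move=> t; rewrite gt_max => /andP[h _]; exact: HC.
- by move=> t; rewrite gt_max => /andP[_ h]; exact: HM'.
Qed.
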